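(* Let $G=\langle S,T\rangle$. Then $G\cong PSL(2,13)$.
   Context: Let $\zeta=e^{2\pi i/13}$. Let $T=\mathrm{diag}(\zeta^7,\zeta^{11},\zeta^8,\zeta^6,\zeta^2,\zeta^5)$ and $$S=-\frac{2i}{\sqrt{13}}\begin{pmatrix} -\sin\frac{2\pi}{13}&-\sin\frac{6\pi}{13}&\sin\frac{5\pi}{13}&\sin\frac{3\pi}{13}&\sin\frac{4\pi}{13}&\sin\frac{\pi}{13}\\ -\sin\frac{6\pi}{13}&\sin\frac{5\pi}{13}&-\sin\frac{2\pi}{13}&\sin\frac{4\pi}{13}&\sin\frac{\pi}{13}&\sin\frac{3\pi}{13}\\ \sin\frac{5\pi}{13}&-\sin\frac{2\pi}{13}&-\sin\frac{6\pi}{13}&\sin\frac{\pi}{13}&\sin\frac{3\pi}{13}&\sin\frac{4\pi}{13}\\ \sin\frac{3\pi}{13}&\sin\frac{4\pi}{13}&\sin\frac{\pi}{13}&\sin\frac{2\pi}{13}&\sin\frac{6\pi}{13}&-\sin\frac{5\pi}{13}\\ \sin\frac{4\pi}{13}&\sin\frac{\pi}{13}&\sin\frac{3\pi}{13}&\sin\frac{6\pi}{13}&-\sin\frac{5\pi}{13}&\sin\frac{2\pi}{13}\\ \sin\frac{\pi}{13}&\sin\frac{3\pi}{13}&\sin\frac{4\pi}{13}&-\sin\frac{5\pi}{13}&\sin\frac{2\pi}{13}&\sin\frac{6\pi}{13} \end{pmatrix}.$$ These are $6\times6$ complex matrices acting on $\mathbb{P}^5$; $G$ is regarded as acting projectively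 (relations such as $(Q^3P^4)^3=-I$ with $P=ST^{-1}S$, $Q=ST^3$ hold up to scalars), so the isomorphism is for the group of projective transformations generated by $S$ and $T$. *)

(* Defs.v *)
From HB Require Import structures.
From mathcomp Require Import all_boot all_order all_algebra all_fingroup all_solvable.
From mathcomp Require Import generic_quotient.
From mathcomp Require Import ring lra.
From mathcomp Require Import boolp classical_sets reals trigo.
From mathcomp Require Import complex.

Set Implicit Arguments.
Unset Strict Implicit.
Unset Printing Implicit Defensive.

Import Order.TTheory GRing.Theory Num.Theory.

Local Open Scope ring_scope.

(* The library's {'GL_n[R]} is restricted to finite rings. *)
Section GeneralLinearGroup.
Variables (F : fieldType) (n : nat).

Record GLin := MkGLin { GLin_mx :> 'M[F]_n; GLin_unit : GLin_mx \in unitmx }.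

HB.instance Definition _ := [isSub for GLin_mx].
HB.instance Definition _ := [Choice of GLin by <:].

Fact GLin_mul_unit (A B : GLin) : (A : 'M_n) *m B \in unitmx.
Proof. by rewrite unitmx_mul !GLin_unit. Qed.

Fact GLin_inv_unit (A : GLin) : invmx A \in unitmx.
Proof. by rewrite unitmx_inv GLin_unit. Qed.

Definition GLin_one := MkGLin (unitmx1 F n).
Definition GLin_mul A B := MkGLin (GLin_mul_unit A B).
Definition GLin_inv A := MkGLin (GLin_inv_unit A).

Fact GLin_mulA : associative GLin_mul.
Proof. by move=> A B C; apply: val_inj; rewrite /= mulmxA. Qed.

Fact GLin_mul1 : left_id GLin_one GLin_mul.
Proof. by move=> A; apply: val_inj; rewrite /= mul1mx. Qed.

Fact GLin_mulr1 : right_id GLin_one GLin_mul.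
Proof. by move=> A; apply: val_inj; rewrite /= mulmx1. Qed.

Fact GLin_mulV : left_inverse GLin_one GLin_inv GLin_mul.
Proof. by move=> A; apply: val_inj; rewrite /= mulVmx ?GLin_unit. Qed.

Fact GLin_mulrV : right_inverse GLin_one GLin_inv GLin_mul.
Proof. by move=> A; apply: val_inj; rewrite /= mulmxV ?GLin_unit. Qed.

HB.instance Definition _ := isGroup.Build GLin
  GLin_mulA GLin_mul1 GLin_mulr1 GLin_mulV GLin_mulrV.

End GeneralLinearGroup.

Section ProjectiveLinearGroup.
Variables (F : fieldType) (n : nat).

(* PGL_n(F) is the quotient of GL_n(F) by the subgroup of scalar matrices. *)
Definition proj_rel (A B : GLin F n) := is_scalar_mx (val (A * B^-1)%g).

Lemma proj_relP (A B : GLin F n) :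
  reflect (exists c, (A : 'M_n) = c *: (B : 'M_n)) (proj_rel A B).
Proof.
apply: (iffP is_scalar_mxP) => -[c Ac]; exists c.
  by rewrite -[LHS](mulmxKV (GLin_unit B)) [_ *m invmx B]Ac mul_scalar_mx.
by rewrite /= Ac -scalemxAl mulmxV ?GLin_unit // scalemx1.
Qed.

Fact proj_rel_refl : reflexive proj_rel.
Proof. by move=> A; apply/proj_relP; exists 1; rewrite scale1r. Qed.

Fact proj_rel_sym : symmetric proj_rel.
Proof.
have sym A B : proj_rel A B -> proj_rel B A.
  move=> /proj_relP[c Ac]; apply/proj_relP.
  have [c0|c0] := eqVneq c 0; last by exists c^-1; rewrite Ac scalerK.
  case: n A B Ac => [|m] A B Ac; first by exists 0; apply/matrixP => -[].
  by have := GLin_unit A; rewrite Ac c0 scale0r unitmxE det0 unitr0.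
by move=> A B; apply/idP/idP => /sym.
Qed.

Fact proj_rel_trans : transitive proj_rel.
Proof.
move=> B A C /proj_relP[c Ac] /proj_relP[d Bd]; apply/proj_relP.
by exists (c * d); rewrite Ac Bd scalerA.
Qed.

Canonical proj_equiv := EquivRel proj_rel proj_rel_refl proj_rel_sym proj_rel_trans.

Definition PGLin := {eq_quot proj_equiv}%qT.

HB.instance Definition _ := Choice.on PGLin.
HB.instance Definition _ : EqQuotient _ proj_equiv PGLin := EqQuotient.on PGLin.

Definition projective (A : GLin F n) : PGLin := \pi_(PGLin)%qT A.

Lemma projectiveP (A B : GLin F n) :
  reflect (projective A = projective B) (proj_rel A B).
Proof. by apply: (iffP idP) => [?|/eqmodP//]; apply/eqmodP. Qed.

Lemma projectiveK (x : PGLin) : projective (repr x) = x.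
Proof. exact: reprK. Qed.

Lemma repr_projective (A : GLin F n) : proj_rel (repr (projective A)) A.
Proof. by apply/projectiveP; rewrite projectiveK. Qed.

Definition PGLin_one : PGLin := projective 1%g.
Definition PGLin_mul (x y : PGLin) : PGLin := projective (repr x * repr y)%g.
Definition PGLin_inv (x : PGLin) : PGLin := projective (repr x)^-1%g.

Fact PGLin_mulE A B :
  PGLin_mul (projective A) (projective B) = projective (A * B)%g.
Proof.
apply/projectiveP/proj_relP.
have /proj_relP[c Ac] := repr_projective A.
have /proj_relP[d Bd] := repr_projective B.
by exists (c * d); rewrite /= Ac Bd -scalemxAl -scalemxAr scalerA.
Qed.

Fact PGLin_invE A : PGLin_inv (projective A) = projective A^-1%g.
Proof.
apply/projectiveP/proj_relP.
have := repr_projective A; rewrite proj_rel_sym => /proj_relP[c Ac].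
exists c; rewrite /=.
apply: (can_inj (mulKmx (GLin_unit A))).
rewrite -scalemxAr mulmxV ?GLin_unit // {1}Ac -scalemxAl.
by rewrite mulmxV ?GLin_unit.
Qed.

Fact PGLin_mulA : associative PGLin_mul.
Proof.
move=> x y z; rewrite -(projectiveK x) -(projectiveK y) -(projectiveK z).
by rewrite !PGLin_mulE mulgA.
Qed.

Fact PGLin_mul1 : left_id PGLin_one PGLin_mul.
Proof. by move=> x; rewrite -(projectiveK x) PGLin_mulE mul1g. Qed.

Fact PGLin_mulr1 : right_id PGLin_one PGLin_mul.
Proof. by move=> x; rewrite -(projectiveK x) PGLin_mulE mulg1. Qed.

Fact PGLin_mulV : left_inverse PGLin_one PGLin_inv PGLin_mul.
Proof. by move=> x; rewrite -(projectiveK x) PGLin_invE PGLin_mulE mulVg. Qed.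

Fact PGLin_mulrV : right_inverse PGLin_one PGLin_inv PGLin_mul.
Proof. by move=> x; rewrite -(projectiveK x) PGLin_invE PGLin_mulE mulgV. Qed.

HB.instance Definition _ := isGroup.Build PGLin
  PGLin_mulA PGLin_mul1 PGLin_mulr1 PGLin_mulV PGLin_mulrV.

End ProjectiveLinearGroup.

Section GeneratedSubgroup.
Variable G : groupType.
Local Open Scope group_scope.
Local Open Scope classical_set_scope.

Definition is_subgroup (H : set G) :=
  H 1 /\ forall x y, H x -> H y -> H (x * y^-1).

Definition gen_subgroup (A : set G) : set G := smallest is_subgroup A.

Variable A : set G.

Definition gen_groupType := {x : G | x \in gen_subgroup A}.

HB.instance Definition _ := SubChoice.on gen_groupType.

Fact gen_groupType_closed : group_closed [pred x : G | x \in gen_subgroup A].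
Proof.
split=> [|x y]; rewrite !inE.
  by move=> H [[H1 _] _].
move=> Ax Ay H AH; have [[_ HF] _] := AH.
by apply: HF; [apply: Ax | apply: Ay].
Qed.

HB.instance Definition _ :=
  SubChoice_isSubGroup.Build G _ gen_groupType gen_groupType_closed.

End GeneratedSubgroup.

Definition group_isomorphic (G H : groupType) :=
  exists f : {multiplicative G -> H}, bijective f.

Section ProjectiveSpecialLinearGroup.
Variables (n : nat) (F : finFieldType).
Local Open Scope group_scope.

(* {'GL_n[F]} consists of matrices of size n.-1.+1, so n must be positive. *)
Definition SL : {set {'GL_n[F]}} := [set u | \det (GLval u) == 1%R].

Fact SL_group_set : group_set SL.
Proof.
apply/group_setP; split=> [|u v]; rewrite !inE; first by rewrite GL_1E det1.
by rewrite GL_ME det_mulmx => /eqP-> /eqP->; rewrite mulr1.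
Qed.

Canonical SL_group := Group SL_group_set.

Definition PSL := SL / 'Z(SL).

Canonical PSL_group := [group of PSL].

End ProjectiveSpecialLinearGroup.

Section Generators.
Variable R : realType.
Local Open Scope complex_scope.

(* e^(2 pi i / 13), through Euler's formula. *)
Definition zeta13 : R[i] := cos (2 * pi / 13) +i* sin (2 * pi / 13).

Definition sin13 (k : nat) : R := sin (k%:R * pi / 13).

Definition sin_table : seq (seq R) :=
  let s := sin13 in
  [:: [:: - s 2; - s 6;   s 5;   s 3;   s 4;   s 1];
      [:: - s 6;   s 5; - s 2;   s 4;   s 1;   s 3];
      [::   s 5; - s 2; - s 6;   s 1;   s 3;   s 4];
      [::   s 3;   s 4;   s 1;   s 2;   s 6; - s 5];
      [::   s 4;   s 1;   s 3;   s 6; - s 5;   s 2];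
      [::   s 1;   s 3;   s 4; - s 5;   s 2;   s 6]].

Definition sin_mx : 'M[R]_6 := \matrix_(i, j) (nth [::] sin_table i)`_j.

Definition S_mx : 'M[R[i]]_6 :=
  - (2 * 'i / (Num.sqrt 13)%:C) *: map_mx (real_complex R) sin_mx.

Definition T_mx : 'M[R[i]]_6 :=
  diag_mx (\row_j zeta13 ^+ nth 0%N [:: 7; 11; 8; 6; 2; 5]%N j).

Let cos13 (k : nat) : R := cos (k%:R * pi / 13).

Let sin13M (a b : nat) : (b <= a)%N ->
  sin13 a * sin13 b = (cos13 (a - b) - cos13 (a + b)) / 2.
Proof.
move=> ba; rewrite /sin13 /cos13 natrB // natrD !mulrBl !mulrDl cosB cosD; lra.
Qed.

Let cos13_odd (k : nat) : (k <= 13)%N -> cos13 k = - cos13 (13 - k).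
Proof.
move=> k13; rewrite /cos13 natrB //.
have -> : (13 - k%:R) * pi / 13 = pi - k%:R * pi / 13 :> R by field.
by rewrite cosB cospi sinpi; lra.
Qed.

Let cos13_sum :
  cos13 2 + cos13 4 + cos13 6 + cos13 8 + cos13 10 + cos13 12 = - (1 / 2).
Proof.
have step (k : nat) : 2 * (sin13 1 * cos13 k.+1) = sin13 k.+2 - sin13 k.
  rewrite /sin13 /cos13.
  have -> : k.+2%:R * pi / 13 = k.+1%:R * pi / 13 + 1 * pi / 13 :> R.
    by rewrite -[k.+2]addn1 natrD; ring.
  have -> : k%:R * pi / 13 = k.+1%:R * pi / 13 - 1 * pi / 13 :> R.
    by rewrite -addn1 natrD; ring.
  by rewrite sinD sinB; lra.
have s1 : sin13 1 != 0.
  have p0 := pi_gt0 R.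
  by rewrite /sin13 gt_eqF // sin_gt0_pi //; apply/andP; split; lra.
have s13 : sin13 13 = 0.
  by rewrite /sin13 mulrAC divff ?pnatr_eq0 // mul1r sinpi.
have e2 := step 1%N; have e4 := step 3; have e6 := step 5.
have e8 := step 7; have e10 := step 9; have e12 := step 11.
apply: (mulfI s1); lra.
Qed.

Lemma sin_mx_sqr : sin_mx *m sin_mx = (13 / 4)%:M.
Proof.
have p11 := sin13M (isT : (1 <= 1)%N). have p21 := sin13M (isT : (1 <= 2)%N).
have p22 := sin13M (isT : (2 <= 2)%N). have p31 := sin13M (isT : (1 <= 3)%N).
have p32 := sin13M (isT : (2 <= 3)%N). have p33 := sin13M (isT : (3 <= 3)%N).
have p41 := sin13M (isT : (1 <= 4)%N). have p42 := sin13M (isT : (2 <= 4)%N).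
have p43 := sin13M (isT : (3 <= 4)%N). have p44 := sin13M (isT : (4 <= 4)%N).
have p51 := sin13M (isT : (1 <= 5)%N). have p52 := sin13M (isT : (2 <= 5)%N).
have p53 := sin13M (isT : (3 <= 5)%N). have p54 := sin13M (isT : (4 <= 5)%N).
have p55 := sin13M (isT : (5 <= 5)%N). have p61 := sin13M (isT : (1 <= 6)%N).
have p62 := sin13M (isT : (2 <= 6)%N). have p63 := sin13M (isT : (3 <= 6)%N).
have p64 := sin13M (isT : (4 <= 6)%N). have p65 := sin13M (isT : (5 <= 6)%N).
have p66 := sin13M (isT : (6 <= 6)%N).
have q1 := cos13_odd (isT : (1 <= 13)%N). have q3 := cos13_odd (isT : (3 <= 13)%N).
have q5 := cos13_odd (isT : (5 <= 13)%N). have q7 := cos13_odd (isT : (7 <= 13)%N).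
have q9 := cos13_odd (isT : (9 <= 13)%N). have q11 := cos13_odd (isT : (11 <= 13)%N).
have q0 : cos13 0 = 1 by rewrite /cos13 !mul0r cos0.
have cs := cos13_sum.
rewrite /subn /addn /= in p11 p21 p22 p31 p32 p33 p41 p42 p43 p44 p51 p52 p53 p54.
rewrite /subn /addn /= in p55 p61 p62 p63 p64 p65 p66 q1 q3 q5 q7 q9 q11.
apply/matrixP => i j; rewrite !mxE.
under eq_bigr do rewrite !mxE.
rewrite !big_ord_recl big_ord0 /=.
case: i => -[|[|[|[|[|[|//]]]]]] ?; case: j => -[|[|[|[|[|[|//]]]]]] ? /=;
  rewrite ?mulr1n ?mulr0n; lra.
Qed.

Lemma S_mx_unit : S_mx \in unitmx.
Proof.
have c0 : - (2 * 'i / (Num.sqrt 13)%:C) != 0 :> R[i].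
  rewrite oppr_eq0 !mulf_neq0 ?pnatr_eq0 ?invr_eq0 //.
    by rewrite eq_complex /= oner_eq0 andbF.
  by rewrite eq_complex /= eqxx andbT sqrtr_eq0 -ltNge ltr0n.
rewrite unitmxZ ?unitfE // map_unitmx.
have : sin_mx *m sin_mx \in unitmx.
  rewrite sin_mx_sqr unitmxE det_scalar unitrX // unitfE lt0r_neq0 //.
  by rewrite divr_gt0 // ltr0n.
by rewrite unitmx_mul => /andP[].
Qed.

Lemma T_mx_unit : T_mx \in unitmx.
Proof.
rewrite unitmxE det_diag unitr_prod_in //= => j _; rewrite mxE unitrX // unitfE.
rewrite eq_complex; apply/negP => /andP[/eqP /= c0 /eqP /= s0].
have := cos2Dsin2 (2 * pi / 13 : R); rewrite c0 s0 expr0n addr0 => /eqP.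
by rewrite eq_sym oner_eq0.
Qed.

Definition S_GL : GLin R[i] 6 := MkGLin S_mx_unit.
Definition T_GL : GLin R[i] 6 := MkGLin T_mx_unit.

End Generators.

(* Main.v *)
From HB Require Import structures.
Require Import Defs.
From mathcomp Require Import all_boot all_order all_algebra all_fingroup.
From mathcomp Require Import classical_sets reals complex.
From mathcomp Require Import center boolp functions trigo ring.

(** [S] and [T] are the Weil representation of SL(2, 13) on the odd functions on
    F_13: choosing the representatives x = 1, 3, 9, 8, 11, 7 of the nonzero
    elements up to sign and psi u = zeta ^ u, one has T = diag (psi (x^2 / 2)) and
    S = (psi (x y) - psi (- x y)) / sqrt 13.  The projective representation is given
    on all of SL(2, 13) by an explicit kernel, and right multiplication by [S] and
    [T] follows the kernel, up to a scalar, by completing a square in a Gauss sum.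
    Since 0 1 -1 0 and 1 1 0 1 generate SL(2, 13), and only +1 and -1 act by
    scalars, the group of projective transformations is SL(2, 13) / {+1, -1}.  No
    Gauss sum has to be evaluated, nor shown nonzero: the scalars are nonzero
    because [S] and [T] are invertible. *)

Set Implicit Arguments.
Unset Strict Implicit.
Unset Printing Implicit Defensive.

Import Order.TTheory GRing.Theory Num.Theory.

Local Open Scope ring_scope.

(** In this order [x ^+ 2 / 2] runs through the exponents 7, 11, 8, 6, 2, 5 of [T_mx]; the choice
    between x and -x fits the signs of the sine table. *)
Definition point13 (i : 'I_6) : 'F_13 := (nth 0%N [:: 1; 3; 9; 8; 11; 7]%N i)%:R.

Lemma sum_point13 (A : comPzRingType) (f : 'F_13 -> A) :
  \sum_y f y = f 0 + \sum_i (f (point13 i) + f (- point13 i)).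
Proof.
transitivity (\sum_(i < 13) f i%:R).
  by apply: eq_bigr => i _; congr f; rewrite natr_Zp.
rewrite !big_ord_recl !big_ord0 /point13 /= /bump /=.
have e (m n : nat) : (m + n = 13)%N -> - m%:R = n%:R :> 'F_13.
  move=> mn; apply/eqP; rewrite eq_sym -addr_eq0 -natrD addnC mn.
  exact/eqP/val_inj.
rewrite (e 1 12)%N // (e 3 10)%N // (e 9 4)%N // (e 8 5)%N //.
rewrite (e 11 2)%N // (e 7 6)%N //.
by ring.
Qed.

(** * The Weil representation of SL(2, 13) on odd functions, up to scalars *)

Section Weil.
Variables (C : fieldType) (z : C).
Hypothesis z_prim : 13.-primitive_root z.

Definition psi (u : 'F_13) : C := z ^+ u.

Lemma psiD u v : psi (u + v) = psi u * psi v.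
Proof. by rewrite /psi -exprD /= -[in RHS](expr_mod _ (prim_expr_order z_prim)). Qed.

Lemma psi_nat n : psi n%:R = z ^+ n.
Proof. by rewrite /psi val_Fp_nat // (expr_mod _ (prim_expr_order z_prim)). Qed.

Lemma psi0 : psi 0 = 1. Proof. by rewrite /psi expr0. Qed.

Lemma psi_inj : injective psi.
Proof.
move=> u v /eqP; rewrite /psi (eq_prim_root_expr z_prim) => /eqP e.
apply: val_inj; move: e; rewrite !modn_small //; exact: ltn_ord.
Qed.

(** Replacing y by 1 + y multiplies the sum by [psi u], which differs from 1 when u is nonzero. *)
Lemma sum_psi (u : 'F_13) : \sum_y psi (u * y) = if u == 0 then 13%:R else 0.
Proof.
have [->|u0] := eqVneq u 0.
  under eq_bigr do rewrite mul0r psi0.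
  by rewrite sumr_const card_Fp.
set s := \sum_y _.
have : psi u * s = s.
  rewrite /s mulr_sumr [RHS](reindex_inj (addrI 1)) /=.
  by apply: eq_bigr => y _; rewrite mulrDr mulr1 psiD.
move/eqP; rewrite -subr_eq0 -[X in _ - X]mul1r -mulrBl mulf_eq0 subr_eq0 -psi0.
by case/orP => [/eqP/psi_inj/eqP|/eqP//]; rewrite (negPf u0).
Qed.

(* The value of [b] is irrelevant for [c != 0], that of [d] for [c = 0]: they are
   determined by [a * d - b * c = 1]. *)
Definition weil_kernel (a b c d x y : 'F_13) : C :=
  if c == 0 then psi (a * b * x ^+ 2 / 2) *+ (y == a * x)
  else psi ((a * x ^+ 2 - 2 * x * y + d * y ^+ 2) / (2 * c)).

(** For odd f, the sum of [weil_kernel a b c d x y * f y] over F_13 folds into a sum over the points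
    [point13] with this kernel. *)
Definition odd_kernel a b c d x y :=
  weil_kernel a b c d x y - weil_kernel a b c d x (- y).

Definition weil_mx a b c d : 'M[C]_6 :=
  \matrix_(i, j) odd_kernel a b c d (point13 i) (point13 j).

(** The new lower-left entry is -d. For c = 0 the sum has a single nonzero term. For c != 0 and d =
    0 the exponent is linear in y, and orthogonality produces the support condition of the new
    kernel. Otherwise it is quadratic and k is a Gauss sum. *)
Lemma weil_kernel_S (a b c d : 'F_13) : a * d - b * c = 1 ->
  exists k, forall x w, \sum_y weil_kernel a b c d x y * psi (y * w)
    = k * weil_kernel (- b) a (- d) c x w.
Proof.
move=> det1; rewrite /weil_kernel oppr_eq0.
have two0 : (2 : 'F_13) != 0 by [].
have [c0|c0] := eqVneq c 0.
  have ad : a * d = 1 by rewrite -det1 c0 mulr0 subr0.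
  have [a0 d0] : a != 0 /\ d != 0.
    by apply/andP; rewrite -negb_or -mulf_eq0 ad oner_eq0.
  rewrite (negPf d0); exists 1 => x w.
  rewrite (bigD1 (a * x)) //= eqxx big1 => [|y /negPf->]; last by rewrite mul0r.
  rewrite addr0 mul1r mulr1n -psiD c0; congr psi.
  have -> : a = d^-1 by rewrite -[LHS](mulfK d0) ad mul1r.
  by field; rewrite ?oppr_eq0 d0.
have [d0|d0] := eqVneq d 0.
  have bc : - b = c^-1.
    by rewrite -[LHS](mulfK c0) mulNr -[- _]add0r -{1}(mulr0 a) -d0 det1 mul1r.
  exists 13%:R => x w; rewrite bc d0.
  transitivity (\sum_y psi (a * x ^+ 2 / (2 * c)) * psi ((w - c^-1 * x) * y)).
    apply: eq_bigr => y _; rewrite -!psiD; congr psi.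
    by field; rewrite ?c0.
  rewrite -mulr_sumr sum_psi subr_eq0.
  case: eqP => _; rewrite ?mulr0n ?mulr0 // mulr1n mulrC; congr (_ * psi _).
  by field; rewrite ?c0.
exists (\sum_y psi (d * y ^+ 2 / (2 * c))) => x w.
(* The shift is to the vertex of the quadratic exponent in y; what remains is [d * y ^+ 2 / (2 * c)]
   plus a term free of y. *)
rewrite (reindex_inj (addrI ((x - c * w) / d))) mulr_suml /=.
apply: eq_bigr => y _; rewrite -!psiD; congr psi.
have -> : a = (1 + b * c) / d by rewrite -det1 subrK mulfK.
by field; rewrite ?oppr_eq0 d0 c0.
Qed.

Lemma weil_kernel_fourier x y : weil_kernel 0 1 (-1) 0 x y = psi (x * y).
Proof.
rewrite /weil_kernel oppr_eq0 oner_eq0; congr psi.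
by field; rewrite ?oppr_eq0 ?oner_eq0.
Qed.

(** The sums over F_13 for w and -w are subtracted and then folded: the summand vanishes at y = 0,
    and the terms at y and -y add up to a product of two odd kernels. *)
Lemma weil_mx_mulS (a b c d : 'F_13) : a * d - b * c = 1 ->
  exists k, weil_mx a b c d *m weil_mx 0 1 (-1) 0 = k *: weil_mx (- b) a (- d) c.
Proof.
move=> det1; have [k kP] := weil_kernel_S det1; exists k.
apply/matrixP => i j; rewrite !mxE; under eq_bigr do rewrite !mxE.
set x := point13 i; set w := point13 j.
rewrite /odd_kernel mulrBr -!kP -sumrB sum_point13.
rewrite !mul0r subrr add0r; apply: eq_bigr => l _.
by rewrite !weil_kernel_fourier !(mulNr, mulrN) !opprK; ring.
Qed.

(** For c != 0 the factor [psi (y ^+ 2 / 2)] raises d by c in the exponent; for c = 0 one has y = a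
    x, and it raises a b by a^2. Being even in y, it passes to the odd kernel. *)
Lemma weil_mx_mulT (a b c d : 'F_13) : a * d - b * c = 1 ->
  weil_mx a b c d *m diag_mx (\row_j psi (point13 j ^+ 2 / 2))
    = weil_mx a (a + b) c (c + d).
Proof.
move=> det1; apply/matrixP => i j; rewrite mul_mx_diag !mxE /odd_kernel mulrBl.
have tE x y : weil_kernel a b c d x y * psi (y ^+ 2 / 2)
    = weil_kernel a (a + b) c (c + d) x y.
  rewrite /weil_kernel; have [c0|c0] := eqVneq c 0.
    case: eqP => [->|_]; last by rewrite !mulr0n mul0r.
    by rewrite !mulr1n -psiD; congr psi; field.
  by rewrite -psiD; congr psi; field; rewrite c0.
by rewrite -!tE sqrrN.
Qed.

Lemma weil_mx1 : weil_mx 1 0 0 1 = 1%:M.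
Proof.
apply/matrixP => i j; rewrite !mxE /odd_kernel /weil_kernel eqxx.
rewrite mulr0 !mul0r psi0 mul1r.
have -> : (- point13 j == point13 i) = false.
  by case: i j => -[|[|[|[|[|[|//]]]]]] ? [[|[|[|[|[|[|//]]]]]] ?].
rewrite mulr0n subr0; congr (_ *+ nat_of_bool _).
by case: i j => -[|[|[|[|[|[|//]]]]]] ? [[|[|[|[|[|[|//]]]]]] ?].
Qed.

(** The kernel of -g at y is that of g at -y: the matrix -1 acts by reflection, hence as -1 on odd
    functions. *)
Lemma weil_mxN a b c d : weil_mx (- a) (- b) (- c) (- d) = - weil_mx a b c d.
Proof.
apply/matrixP => i j; rewrite !mxE /odd_kernel /weil_kernel oppr_eq0 opprB.
case: eqVneq => [_|c0].
  by rewrite mulrNN mulNr eqr_opp -eqr_oppLR.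
by congr (psi _ - psi _); field; rewrite ?oppr_eq0 c0.
Qed.

(** If c != 0, the entry at x = 1, y = 3 cannot vanish, since its two exponents differ by 6 / c. If
    c = 0, the entry at x = y = 1 is nonzero only for a = 1 or a = -1, and equality of the diagonal
    entries at 1 and 3 gives 4 a b = 0. *)
Lemma weil_mx_scalar (a b c d : 'F_13) k : a * d - b * c = 1 ->
  k != 0 -> k *: weil_mx a b c d = 1%:M ->
  [/\ b = 0, c = 0 & (a = 1 /\ d = 1) \/ (a = -1 /\ d = -1)].
Proof.
move=> det1 k0 /matrixP kM.
have {kM} E i j : odd_kernel a b c d (point13 i) (point13 j) = k^-1 *+ (i == j).
  apply: (mulfI k0); have := kM i j; rewrite !mxE => ->.
  by rewrite mulrnAr divff.
pose o (i : nat) : 'I_6 := inord i.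
have x0 : point13 (o 0%N) = 1 by rewrite /point13 inordK.
have x1 : point13 (o 1%N) = 3%:R by rewrite /point13 inordK.
have c0 : c = 0.
  apply/eqP/negPn/negP => c0.
  have := E (o 0%N) (o 1%N); rewrite x0 x1 -val_eqE /= !inordK // mulr0n.
  rewrite /odd_kernel /weil_kernel (negPf c0) => /eqP.
  rewrite subr_eq0 => /eqP/psi_inj/(congr1 (fun u => u * c)) /eqP.
  rewrite -subr_eq0.
  set u := (X in X == 0); have -> : u = - 6%:R by rewrite /u; field; rewrite c0.
  by [].
have ad : a * d = 1 by rewrite -det1 c0 mulr0 subr0.
have := E (o 0%N) (o 0%N); have := E (o 1%N) (o 1%N).
rewrite !eqxx x0 x1 /odd_kernel /weil_kernel c0 eqxx !mulr1n.
have a1 : a = 1 \/ a = -1.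
  have := E (o 0%N) (o 0%N).
  rewrite !eqxx x0 /odd_kernel /weil_kernel c0 eqxx mulr1.
  case: eqVneq => [|_]; first by left.
  case: eqVneq => [|_]; first by right.
  by rewrite !mulr0n subrr => /eqP; rewrite mulr1n eq_sym invr_eq0 (negPf k0).
have da : d = a.
  by case: a1 ad => ->; rewrite ?mul1r // mulN1r => /eqP; rewrite eqr_oppLR => /eqP.
have two0 : (2 : 'F_13) != 0 by [].
have b_eq0 : psi (a * b * 3%:R ^+ 2 / 2) = psi (a * b * 1 ^+ 2 / 2) -> b = 0.
  move=> /psi_inj/eqP; rewrite -subr_eq0.
  set u := (X in X == 0); have -> : u = 4%:R * (a * b) by rewrite /u; field.
  rewrite !mulf_eq0; case/or3P => [//||/eqP//].
  by case: a1 => ->.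
move=> e1 e0; split=> //; last by rewrite da; case: a1; [left|right].
apply: b_eq0; move: e1 e0; case: a1 => ->.
  by rewrite !mul1r /= !mulr0n !subr0 !mulr1n => -> ->.
by rewrite !mulN1r /= !mulr0n !sub0r !mulr1n => <- /oppr_inj ->.
Qed.

End Weil.

(** * Generators and centre of SL(2, F) *)

Section SpecialLinear.
Variable F : finFieldType.

Definition mx2 (a b c d : F) : 'M[F]_2 :=
  \matrix_(i, j) if i == 0 then (if j == 0 then a else b)
                 else (if j == 0 then c else d).

Lemma mx2_eta (A : 'M[F]_2) : A = mx2 (A 0 0) (A 0 1) (A 1 0) (A 1 1).
Proof.
apply/matrixP => i j; rewrite mxE.
by case: i j => -[|[|//]] ? [[|[|//]] ?] /=; congr (A _ _); apply: val_inj.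
Qed.

Lemma det_mx2 a b c d : \det (mx2 a b c d) = a * d - b * c.
Proof.
rewrite (expand_det_row _ 0) !big_ord_recl big_ord0 /cofactor !det_mx11 !mxE /=.
by rewrite /=; ring.
Qed.

Lemma mulmx2 a b c d a' b' c' d' : mx2 a b c d *m mx2 a' b' c' d' =
  mx2 (a * a' + b * c') (a * b' + b * d') (c * a' + d * c') (c * b' + d * d').
Proof.
apply/matrixP => i j; rewrite !mxE !big_ord_recl big_ord0 !mxE addr0 /=.
by case: eqP => _; case: eqP => _.
Qed.

Lemma mx2_inj a b c d a' b' c' d' : mx2 a b c d = mx2 a' b' c' d' ->
  [/\ a = a', b = b', c = c' & d = d'].
Proof.
move=> /matrixP E.
by have := E 0 0; have := E 0 1; have := E 1 0; have := E 1 1; rewrite !mxE.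
Qed.

Lemma GLval_inj : injective (@GLval 2 F).
Proof. exact: val_inj. Qed.

(* Junk value [1] if the matrix is singular. *)
Definition sl2 (a b c d : F) : {'GL_2[F]} :=
  insubd (1%g : {'GL_2[F]}) (mx2 a b c d).

Lemma sl2E a b c d : a * d - b * c = 1 -> GLval (sl2 a b c d) = mx2 a b c d.
Proof.
move=> det1; rewrite /sl2 -[LHS]/(val _) val_insubd /=.
by rewrite unitmxE det_mx2 det1 unitr1.
Qed.

Lemma sl2P (g : {'GL_2[F]}) : g \in SL 2 F ->
  exists a b c d, a * d - b * c = 1 /\ g = sl2 a b c d.
Proof.
rewrite inE => /eqP; rewrite (mx2_eta (GLval g)) det_mx2 => det1.
by do 4!eexists; split; [exact: det1|apply: GLval_inj; rewrite sl2E // -mx2_eta].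
Qed.

Lemma sl2_in a b c d : a * d - b * c = 1 -> sl2 a b c d \in SL 2 F.
Proof. by move=> det1; rewrite inE sl2E // det_mx2 det1. Qed.

Lemma sl2M a b c d a' b' c' d' : a * d - b * c = 1 -> a' * d' - b' * c' = 1 ->
  (sl2 a b c d * sl2 a' b' c' d')%g =
  sl2 (a * a' + b * c') (a * b' + b * d') (c * a' + d * c') (c * b' + d * d').
Proof.
move=> e e'; apply: GLval_inj; rewrite GL_MxE !sl2E ?mulmx2 //.
by rewrite -[RHS](mulr1 1) -{1}e -e'; ring.
Qed.

Definition sl2S := sl2 0 1 (-1) 0.
Definition sl2T := sl2 1 1 0 1.

Lemma sl2S_in : sl2S \in SL 2 F.
Proof. by apply: sl2_in; ring. Qed.

Lemma sl2T_in : sl2T \in SL 2 F.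
Proof. by apply: sl2_in; ring. Qed.

Lemma sl2_id : sl2 1 0 0 1 = 1%g.
Proof.
apply: GLval_inj; rewrite sl2E ?mulr0 ?subr0 ?mulr1 //.
by rewrite [RHS]mx2_eta GL_1E !mxE.
Qed.

Lemma sl2MS a b c d : a * d - b * c = 1 ->
  (sl2 a b c d * sl2S)%g = sl2 (- b) a (- d) c.
Proof. by move=> det1; rewrite sl2M //; [congr sl2; ring | ring]. Qed.

Lemma sl2MT a b c d : a * d - b * c = 1 ->
  (sl2 a b c d * sl2T)%g = sl2 a (a + b) c (c + d).
Proof. by move=> det1; rewrite sl2M //; [congr sl2; ring | ring]. Qed.

Lemma sl2MN a b c d : a * d - b * c = 1 ->
  (sl2 a b c d * sl2 (-1) 0 0 (-1))%g = sl2 (- a) (- b) (- c) (- d).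
Proof. by move=> det1; rewrite sl2M //; [congr sl2; ring | ring]. Qed.

(** The hypothesis makes F a prime field, so that the upper unipotent matrices are powers of [sl2T].
    Together with [sl2S] they give the upper triangular matrices, to which all others are
    reduced. *)
Lemma SL2_gen : (forall u : F, exists n : nat, u = n%:R) ->
  (SL 2 F \subset <<[set sl2S; sl2T]>>)%g.
Proof.
move=> F_prime.
set H := <<_>>%g.
have HS : sl2S \in H by rewrite mem_gen // !inE eqxx.
have HT : sl2T \in H by rewrite mem_gen // !inE eqxx orbT.
have HTn (u : F) : sl2 1 u 0 1 \in H.
  have [n ->] := F_prime u; elim: n => [|n IH].
    by rewrite sl2_id group1.
  have := groupM IH HT; rewrite /sl2T sl2M; try by rewrite mulr0 subr0 mulr1.
  by rewrite !mulr1 !mulr0 !addr0 add0r addrC natr1.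
have HU (a b d : F) : a * d = 1 -> sl2 a b 0 d \in H.
  move=> ad.
  have a0 : a != 0 by apply: contra_eq_neq ad => ->; rewrite mul0r eq_sym oner_eq0.
  have -> : d = a^-1 by rewrite -[LHS](mulKf a0) ad mulr1.
  (* diag (a, a^-1) = T^a S T^(1/a) S T^a S *)
  have HTS (u : F) := groupM (HTn u) HS.
  (* The leading factor T^(a b) gives the diagonal matrix its upper-right entry b. *)
  have := groupM (groupM (groupM (HTn (a * b)) (HTS a)) (HTS a^-1)) (HTS a).
  rewrite /sl2S !sl2M; try by field; rewrite ?a0.
  set g := sl2 _ _ _ _; suff -> : g = sl2 a b 0 a^-1 by [].
  by congr sl2; field; rewrite ?a0.
apply/fintype.subsetP => g /sl2P [a [b [c [d [det1 ->]]]]].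
have [c0|c0] := eqVneq c 0.
  by rewrite c0 HU // -det1 c0 mulr0 subr0.
(* T^(-d/c) clears the lower-right entry, and [sl2S] then moves this zero to the lower left. *)
rewrite -(groupMr _ (HTn (- d / c))) -(groupMr _ HS) /sl2S !sl2M;
  try by first [ring | rewrite -[RHS]det1; field; rewrite ?c0].
set u := (X in sl2 _ _ X _); have -> : u = 0 by rewrite /u; field.
by apply: HU; rewrite -[RHS]det1; field; rewrite ?c0.
Qed.

(** Commuting with [sl2T] forces c = 0 and a = d, commuting with [sl2S] then forces b = 0, and the
    determinant leaves a^2 = 1. *)
Lemma center_SL2 (g : {'GL_2[F]}) : g \in 'Z(SL 2 F)%g ->
  g = sl2 1 0 0 1 \/ g = sl2 (-1) 0 0 (-1).
Proof.
case/centerP => /sl2P [a [b [c [d [det1 ->]]]]] gC.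
have detS : 0 * 0 - 1 * (-1) = 1 :> F by ring.
have detT : 1 * 1 - 1 * 0 = 1 :> F by ring.
have := gC _ (sl2_in detS); have := gC _ (sl2_in detT).
rewrite /commute !sl2M // => /(congr1 (@GLval _ _)).
rewrite !sl2E; try by rewrite -[RHS]det1; ring.
move=> /mx2_inj [].
rewrite !(mulr0, mul0r, mulr1, mul1r, addr0, add0r, mulrN, mulNr).
move=> /eqP + /eqP + _ _.
rewrite -subr_eq0 opprD addrA subrr sub0r oppr_eq0 => /eqP c0.
rewrite [b + d]addrC => /eqP/addIr ad.
move=> /(congr1 (@GLval _ _)); rewrite !sl2E; try by rewrite -[RHS]det1; ring.
move=> /mx2_inj [].
rewrite c0 => /eqP.
rewrite oppr_eq0 => /eqP b0 _ _ _; rewrite b0.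
move: det1; rewrite b0 mul0r subr0 ad => /eqP; rewrite -expr2 sqrf_eq1.
by case/orP => /eqP->; [left|right].
Qed.

Lemma center_SL2N : sl2 (-1) 0 0 (-1) \in 'Z(SL 2 F)%g.
Proof.
apply/centerP; split; first by rewrite sl2_in //; ring.
move=> g /sl2P [a [b [c [d [det1 ->]]]]]; rewrite /commute !sl2M //; try ring.
by congr sl2; ring.
Qed.

Section Entries.
Variables (X : Type) (m : F -> F -> F -> F -> X).

(** Turns a family indexed by four entries, such as [weil_mx], into a function of a group element,
    the form in which a projective representation is handled later. *)
Definition on_entries (g : {'GL_2[F]}) : X :=
  m (GLval g 0 0) (GLval g 0 1) (GLval g 1 0) (GLval g 1 1).

Lemma on_entries1 : on_entries 1%g = m 1 0 0 1.
Proof. by rewrite /on_entries GL_1E !mxE. Qed.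

Lemma on_entries_sl2 a b c d : a * d - b * c = 1 ->
  on_entries (sl2 a b c d) = m a b c d.
Proof. by move=> det1; rewrite /on_entries sl2E // !mxE. Qed.

Lemma on_entriesMS (P : X -> X -> Prop) :
  (forall a b c d, a * d - b * c = 1 -> P (m a b c d) (m (- b) a (- d) c)) ->
  {in SL 2 F, forall g, P (on_entries g) (on_entries (g * sl2S)%g)}.
Proof.
move=> mP _ /sl2P[a [b [c [d [det1 ->]]]]]; rewrite sl2MS // !on_entries_sl2 //.
  exact: mP.
by rewrite -[RHS]det1; ring.
Qed.

Lemma on_entriesMT (P : X -> X -> Prop) :
  (forall a b c d, a * d - b * c = 1 -> P (m a b c d) (m a (a + b) c (c + d))) ->
  {in SL 2 F, forall g, P (on_entries g) (on_entries (g * sl2T)%g)}.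
Proof.
move=> mP _ /sl2P[a [b [c [d [det1 ->]]]]]; rewrite sl2MT // !on_entries_sl2 //.
  exact: mP.
by rewrite -[RHS]det1; ring.
Qed.

Lemma on_entriesMZ (P : X -> X -> Prop) :
  (forall a b c d, a * d - b * c = 1 -> P (m a b c d) (m a b c d)) ->
  (forall a b c d, a * d - b * c = 1 ->
    P (m a b c d) (m (- a) (- b) (- c) (- d))) ->
  {in SL 2 F & 'Z(SL 2 F)%g, forall g h, P (on_entries g) (on_entries (g * h)%g)}.
Proof.
move=> mP mN _ h /sl2P[a [b [c [d [det1 ->]]]]] /center_SL2[] ->.
  by rewrite sl2_id mulg1 on_entries_sl2 //; apply: mP.
rewrite sl2MN // !on_entries_sl2 //; first exact: mN.
by rewrite -[RHS]det1; ring.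
Qed.

End Entries.

End SpecialLinear.

(** * The given matrices as Weil matrices *)

Section Generators.
Variable R : realType.
Local Open Scope complex_scope.
Local Notation z := (zeta13 R).

Lemma zeta13X n : z ^+ n = cos (2 * n%:R * pi / 13) +i* sin (2 * n%:R * pi / 13).
Proof.
elim: n => [|n IH]; first by rewrite expr0 mulr0 !mul0r cos0 sin0.
rewrite exprS IH.
have -> : 2 * n.+1%:R * pi / 13 = 2 * pi / 13 + 2 * n%:R * pi / 13 :> R.
  by rewrite -[n.+1]addn1 natrD; field.
rewrite cosD sinD /zeta13; simpc.
by rewrite [X in _ +i* X]addrC.
Qed.

(** The order divides the prime 13, and it is not 1 because sin (2 pi / 13) > 0. *)
Lemma zeta13_prim : 13.-primitive_root z.
Proof.
have z13 : z ^+ 13 = 1.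
  rewrite zeta13X.
  have -> : 2 * 13%:R * pi / 13 = pi *+ 2 :> R by rewrite -mulr_natl; field.
  by rewrite cos2pi sin2pi.
have [m m_prim] := prim_order_exists (isT : 0 < 13)%N z13.
have /primeP[_ p13] : prime 13 by [].
move=> /p13 /orP[/eqP m1|/eqP <- //]; move: m_prim; rewrite m1.
move/prim_expr_order; rewrite expr1 /zeta13 => -[_] /eqP.
have p0 := pi_gt0 R.
rewrite gt_eqF // sin_gt0_pi //; apply/andP; split.
  by rewrite divr_gt0 // mulr_gt0.
by rewrite mulrAC -[ltRHS]mul1r ltr_pM2r // ltr_pdivrMr // mul1r ltr_nat.
Qed.

Lemma sin13_sub n : (n <= 13)%N -> sin13 R (13 - n) = sin13 R n.
Proof.
move=> n13; rewrite /sin13 natrB //.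
have -> : (13%:R - n%:R) * pi / 13 = pi - n%:R * pi / 13 :> R by field.
by rewrite sinB sinpi cospi mul0r sub0r mulN1r opprK.
Qed.

Lemma sin13_add n : sin13 R (n + 13) = - sin13 R n.
Proof.
rewrite /sin13 natrD.
have -> : (n%:R + 13%:R) * pi / 13 = n%:R * pi / 13 + pi :> R by field.
by rewrite sinDpi.
Qed.

Lemma psi_odd n : (n <= 13)%N ->
  psi z n%:R - psi z (- n%:R) = 0 +i* (2 * sin13 R (2 * n)).
Proof.
move=> n13; have -> : - n%:R = (13 - n)%:R :> 'F_13.
  by apply/eqP; rewrite eq_sym -addr_eq0 -natrD subnK.
rewrite !(psi_nat zeta13_prim) !zeta13X natrB //.
have -> : 2 * (13%:R - n%:R) * pi / 13 = - (2 * n%:R * pi / 13) + pi *+ 2 :> R.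
  by rewrite -mulr_natl; field.
rewrite cosD2pi sinD2pi cosN sinN /sin13 natrM.
by apply/eqP; rewrite eq_complex /= subrr opprK -mulr2n ?mulr_natl ?eqxx.
Qed.

(** All 36 entries are checked: the even index, between 2 and 24, is brought down to 1, ..., 6 by
    sin (pi - t) = sin t and sin (t + pi) = - sin t. *)
Lemma sin_mxE i j :
  sin_mx R i j = - sin13 R (2 * (nat_of_ord (point13 i * point13 j))).
Proof.
have s8 := sin13_sub (isT : 5 <= 13)%N; have s10 := sin13_sub (isT : 3 <= 13)%N.
have s12 := sin13_sub (isT : 1 <= 13)%N.
have s14 := sin13_add 1; have s16 := sin13_add 3; have s18 := sin13_add 5.
have s20 := sin13_add 7; have s22 := sin13_add 9; have s24 := sin13_add 11.
have s7 := sin13_sub (isT : 6 <= 13)%N; have s9 := sin13_sub (isT : 4 <= 13)%N.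
have s11 := sin13_sub (isT : 2 <= 13)%N.
rewrite /subn /addn /= in s7 s8 s9 s10 s11 s12 s14 s16 s18 s20 s22 s24.
rewrite mxE.
case: i => -[|[|[|[|[|[|//]]]]]] ?; case: j => -[|[|[|[|[|[|//]]]]]] ? /=;
  set n := (2 * _)%N; vm_compute in n; rewrite {}/n;
  by rewrite ?(s14, s16, s18, s20, s22, s24) ?(s7, s8, s9, s10, s11, s12) ?opprK.
Qed.

Lemma S_mxE : S_mx R = (Num.sqrt 13)^-1%:C *: weil_mx z 0 1 (-1) 0.
Proof.
apply/matrixP => i j; rewrite [LHS]mxE [X in _ * X]mxE sin_mxE !mxE.
rewrite /odd_kernel !weil_kernel_fourier mulrN -[point13 i * point13 j]natr_Zp.
rewrite psi_odd; last exact: ltnW.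
rewrite natr_Zp fmorphV; set s := sin13 R _.
have -> : 0 +i* (2 * s) = 2 * 'i * s%:C.
  by apply/eqP; rewrite eq_complex /=; apply/andP; split; apply/eqP; ring.
by rewrite rmorphN; ring.
Qed.

Lemma T_mxE : T_mx R = diag_mx (\row_j psi z (point13 j ^+ 2 / 2)).
Proof.
congr diag_mx; apply/rowP => j; rewrite !mxE -(psi_nat zeta13_prim); congr (psi z _).
by case: j => -[|[|[|[|[|[|//]]]]]] ?; apply: val_inj.
Qed.

End Generators.

(** * From a projective representation known on generators to an isomorphism *)

Section ProjectiveRepresentation.
Variables (gT : finGroupType) (Gamma K : {group gT}) (s t : gT).
Hypotheses (nKG : (K <| Gamma)%g) (Gamma_s : s \in Gamma) (Gamma_t : t \in Gamma).
Hypothesis Gamma_gen : (Gamma \subset <<[set s; t]>>)%g.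
Variables (C : fieldType) (n : nat) (W : gT -> 'M[C]_n.+1) (S T : GLin C n.+1).
Hypothesis W1 : W 1%g = 1%:M.
Hypothesis WS : forall g, g \in Gamma ->
  exists k, W g *m GLin_mx S = k *: W (g * s)%g.
Hypothesis WT : forall g, g \in Gamma ->
  exists k, W g *m GLin_mx T = k *: W (g * t)%g.
Hypothesis WK : forall g h, g \in Gamma -> h \in K ->
  exists k, W g = k *: W (g * h)%g.
Hypothesis W_ker : forall g k, g \in Gamma -> k != 0 -> k *: W g = 1%:M -> g \in K.

Implicit Types (A B : GLin C n.+1) (g h : gT).

(** [W] is assumed multiplicative only against [s] and [t], up to scalars that might vanish, and its
    values are not assumed invertible; hence a relation with invertible matrices. *)
Definition implements A g := exists k, GLin_mx A = k *: W g.

(** This spares the evaluation of Gauss sums: in positive dimension an invertible matrix is nonzero,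
    so the scalar is too. *)
Lemma GLin_scale_neq0 A k (M : 'M_n.+1) : GLin_mx A = k *: M -> k != 0.
Proof.
apply: contra_eq_neq => ->; rewrite scale0r; apply/eqP => A0.
by have := GLin_unit A; rewrite A0 unitmxE det0 unitr0.
Qed.

Lemma projectiveM A B : projective (A * B)%g = (projective A * projective B)%g.
Proof. exact/esym/PGLin_mulE. Qed.

Lemma projectiveV A : projective (A^-1)%g = ((projective A)^-1)%g.
Proof. exact/esym/PGLin_invE. Qed.

Lemma implements_projective A B g : implements A g -> implements B g ->
  projective A = projective B.
Proof.
move=> [k Ak] [l Bl]; apply/projectiveP/proj_relP; exists (k / l).
by rewrite Ak Bl scalerA divfK ?(GLin_scale_neq0 Bl).
Qed.

Lemma implements_eq A B g :
  projective A = projective B -> implements A g -> implements B g.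
Proof.
move=> /esym/projectiveP/proj_relP[k Bk] [l Al].
by exists (k * l); rewrite Bk Al scalerA.
Qed.

Lemma implements1 : implements 1%g 1%g.
Proof. by exists 1; rewrite scale1r W1. Qed.

Lemma implements_mulr A B g h :
  (exists k, W g *m GLin_mx B = k *: W (g * h)%g) ->
  implements A g -> implements (A * B)%g (g * h)%g.
Proof.
move=> [k Bk] [l Al]; exists (l * k).
by rewrite -[LHS]/(GLin_mx A *m GLin_mx B) Al -scalemxAl Bk scalerA.
Qed.

Lemma implements_mulK A g h : g \in Gamma -> h \in K ->
  implements A g -> implements A (g * h)%g.
Proof.
move=> gG hK [l Al]; have [k Wk] := WK gG hK.
by exists (l * k); rewrite Al Wk scalerA.
Qed.

Lemma implements_ker g : g \in Gamma -> implements 1%g g -> g \in K.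
Proof.
move=> gG [k kW]; apply: (W_ker gG (GLin_scale_neq0 kW)).
by rewrite -kW.
Qed.

Local Notation ST := [set projective S; projective T]%classic.
Local Notation G := (gen_subgroup ST).

Lemma gen_subgroup1 : G 1%g. Proof. by move=> H [[]]. Qed.

Lemma gen_subgroupM x y : G x -> G y -> G (x * y)%g.
Proof.
move=> Gx Gy H GH; have [[H1 HD] _] := GH.
rewrite -[y]invgK -[(y^-1)%g]mul1g; apply: (HD); first exact: Gx.
by apply: HD; [exact: H1 | exact: Gy].
Qed.

(* Right multiplication by an implementer of [h] is only known to respect
   [implements] for the generators; the last clause propagates it along words. *)
Definition implementable h := exists B, [/\ G (projective B), implements B h &
  forall A g, g \in Gamma -> implements A g -> implements (A * B)%g (g * h)%g].

Lemma implementable_gen B h : h \in Gamma -> G (projective B) ->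
  (forall g, g \in Gamma -> exists k, W g *m GLin_mx B = k *: W (g * h)%g) ->
  implementable h.
Proof.
move=> hG GB WB; exists B; split=> // [|A g gG]; last exact/implements_mulr/WB.
by have := implements_mulr (WB _ (group1 _)) implements1; rewrite !mul1g.
Qed.

(** The implementable elements of [Gamma] contain [s] and [t] and are closed under products; by
    finiteness they form a subgroup. *)
Lemma implementableP : {in Gamma, forall h, implementable h}.
Proof.
pose D := [set h in Gamma | `[< implementable h >]].
have D_group : group_set D.
  apply/group_setP; split.
    rewrite inE group1; apply/asboolP; exists 1%g; split.
    - exact: gen_subgroup1.
    - exact: implements1.
    by move=> A g _; rewrite !mulg1.
  move=> g h; rewrite !inE => /andP[gG /asboolP[A [GA Ag AP]]].
  move=> /andP[hG /asboolP[B [GB Bh BP]]].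
  rewrite groupM //; apply/asboolP; exists (A * B)%g; split.
  - by rewrite projectiveM; apply: gen_subgroupM.
  - exact: BP.
  move=> A' g' g'G A'g'; rewrite !mulgA; apply: BP; first exact: groupM.
  exact: AP.
suff /fintype.subsetP sub : Gamma \subset Group D_group.
  by move=> h /sub; rewrite inE => /andP[_ /asboolP].
apply: fintype.subset_trans Gamma_gen _.
rewrite gen_subG; apply/fintype.subsetP => h; rewrite !inE => /orP[]/eqP->.
  rewrite Gamma_s; apply/asboolP/(implementable_gen Gamma_s _ WS).
  by move=> H [_]; apply; left.
rewrite Gamma_t; apply/asboolP/(implementable_gen Gamma_t _ WT).
by move=> H [_]; apply; right.
Qed.

(** Any implementer of h has the projective class of the one supplied by [implementableP], and
    [implements] depends only on this class. *)
Lemma implementsM A B g h : g \in Gamma -> h \in Gamma ->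
  implements A g -> implements B h -> implements (A * B)%g (g * h)%g.
Proof.
move=> gG hG Ag Bh; have [B' [_ B'h B'P]] := implementableP hG.
apply: implements_eq (B'P _ _ gG Ag).
by rewrite !projectiveM (implements_projective Bh B'h).
Qed.

Lemma implementsV A g : g \in Gamma -> implements A g ->
  implements (A^-1)%g (g^-1)%g.
Proof.
move=> gG Ag; have [B [_ Bg _]] := implementableP (groupVr gG).
have := implementsM gG (groupVr gG) Ag Bg; rewrite mulgV => AB1.
have /mulg1_eq AB : (projective A * projective B = 1)%g.
  by rewrite -projectiveM (implements_projective AB1 implements1).
by apply: implements_eq Bg; rewrite projectiveV AB.
Qed.

Lemma implements_ex x : G x ->
  exists g, g \in Gamma /\ implements (generic_quotient.repr x) g.
Proof.
(* The smallest subgroup is contained in the set of classes whose representative implements some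
   element of [Gamma], once that set is shown to be a subgroup containing the generators. *)
move=> /(_ (fun x =>
  exists g, g \in Gamma /\ implements (generic_quotient.repr x) g)).
apply; split; first split.
- exists 1%g; split; first exact: group1.
  by apply: implements_eq implements1; rewrite projectiveK.
- move=> x1 y [g [gG xg]] [h [hG yh]]; exists (g * h^-1)%g; split.
    by rewrite groupM ?groupV.
  apply: implements_eq (implementsM gG (groupVr hG) xg (implementsV hG yh)).
  by rewrite projectiveM projectiveV !projectiveK.
move=> y [->|->].
  exists (1 * s)%g; split; first by rewrite mul1g.
  apply: implements_eq (implements_mulr (WS (group1 _)) implements1).
  by rewrite mul1g projectiveK.
exists (1 * t)%g; split; first by rewrite mul1g.
apply: implements_eq (implements_mulr (WT (group1 _)) implements1).
by rewrite mul1g projectiveK.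
Qed.

(** If A implements both g and h, then 1 implements g^-1 h, which therefore lies in [K]; the
    converse is [WK]. This yields both the independence of choices and the injectivity of the
    isomorphism. *)
Lemma implements_coset A g h : g \in Gamma -> h \in Gamma ->
  implements A g -> implements A h <-> coset K g = coset K h.
Proof.
move=> gG hG Ag; have nKg := fintype.subsetP (normal_norm nKG) _ gG.
have nKh := fintype.subsetP (normal_norm nKG) _ hG; split=> [Ah|e].
  have ghK : (g^-1 * h)%g \in K.
    apply: implements_ker; first by rewrite groupM ?groupV.
    have := implementsM (groupVr gG) hG (implementsV gG Ag) Ah.
    by rewrite mulVg.
  by rewrite -[h](mulKVg g) morphM ?groupM ?groupV //= (coset_id ghK) mulg1.
have ghK : (g^-1 * h)%g \in K.
  rewrite coset_idr ?groupM ?groupV // morphM ?groupV // morphV //=.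
  by rewrite e mulVg.
by rewrite -[h](mulKVg g); apply: implements_mulK.
Qed.

(** A class is sent to the coset of a chosen element that its representative implements;
    surjectivity comes from [implementableP]. *)
Lemma gen_groupType_iso : group_isomorphic (gen_groupType ST) [subg Gamma / K].
Proof.
have ex (x : gen_groupType ST) :
    exists g, g \in Gamma /\ implements (generic_quotient.repr (val x)) g.
  by apply: implements_ex; have := valP x; rewrite inE.
pose w x := sval (cid (ex x)).
have wG x : w x \in Gamma by case: (svalP (cid (ex x))).
have wP x : implements (generic_quotient.repr (val x)) (w x).
  by case: (svalP (cid (ex x))).
have cG g : g \in Gamma -> coset K g \in (Gamma / K)%G.
  by move=> gG; apply: mem_quotient.
pose f x : [subg Gamma / K] := subg (Gamma / K)%G (coset K (w x)).
have fM : {morph f : x y / (x * y)%g >-> (x * y)%g}.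
  move=> x y; rewrite /f -subgM ?cG //; congr subg.
  have nK h : h \in Gamma -> h \in 'N(K)%g := fintype.subsetP (normal_norm nKG) h.
  rewrite -[RHS]morphM ?nK //.
  apply/(implements_coset _ _ (wP _)); rewrite ?groupM ?wG //.
  apply: implements_eq (implementsM (wG x) (wG y) (wP x) (wP y)).
  by rewrite projectiveM !projectiveK.
exists (HB.pack_for (Multiplicative.type _ _) f
  (isMultiplicative.Build _ _ f fM)) => /=.
(* As a bijection of full sets, the map needs only injectivity and surjectivity, without an explicit
   inverse. *)
rewrite -setTT_bijective; split=> //.
- move=> x y _ _ /(congr1 val); rewrite /= !subgK ?cG // => e.
  apply: val_inj; rewrite -[val x]projectiveK -[val y]projectiveK.
  apply: implements_projective (wP y).
  by apply/(implements_coset _ _ (wP x)).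
move=> u _; have /morphimP[g _ gG ug] := subgP u.
have [B [GB Bg _]] := implementableP gG.
have GB' : projective B \in gen_subgroup ST by rewrite inE.
exists (Sub (projective B) GB') => //; apply: val_inj; rewrite /= subgK ?cG //.
rewrite [RHS]ug; apply/(implements_coset _ _ (wP _)) => //.
by apply: implements_eq Bg; rewrite /= projectiveK.
Qed.

End ProjectiveRepresentation.

Theorem theorem2p1 (R : realType) :
  group_isomorphic
    (gen_groupType [set projective (S_GL R); projective (T_GL R)]%classic)
    [subg PSL_group 2 'F_13].
Proof.
have z_prim := zeta13_prim R.
(* PSL is by definition the quotient by the centre, so the centre is taken for [K]. *)
apply: (@gen_groupType_iso _ (SL_group 2 'F_13) 'Z(SL_group 2 'F_13)%G
  (sl2S 'F_13) (sl2T 'F_13) _ _ _ _ _ _ (on_entries (weil_mx (zeta13 R)))).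
- exact: center_normal.
- exact: sl2S_in.
- exact: sl2T_in.
- by apply: SL2_gen => u; exists (nat_of_ord u); rewrite natr_Zp.
- by rewrite on_entries1 weil_mx1.
- apply: (on_entriesMS (P := fun A B => exists k, A *m S_mx R = k *: B)).
  move=> a b c d det1; have [k kP] := weil_mx_mulS z_prim det1.
  exists ((Num.sqrt 13)^-1%:C%C * k).
  by rewrite S_mxE -scalemxAr kP scalerA.
- apply: (on_entriesMT (P := fun A B => exists k, A *m T_mx R = k *: B)).
  move=> a b c d det1; exists 1.
  by rewrite T_mxE (weil_mx_mulT z_prim det1) scale1r.
- apply: (on_entriesMZ (P := fun A B => exists k, A = k *: B)) => a b c d _.
    by exists 1; rewrite scale1r.
  by exists (-1); rewrite weil_mxN scaleN1r opprK.
(* An element acting by a scalar is 1 or -1, hence central. *)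
move=> _ k /sl2P[a [b [c [d [det1 ->]]]]] k0; rewrite on_entries_sl2 // => kW.
have [-> -> [[-> ->]|[-> ->]]] := weil_mx_scalar z_prim det1 k0 kW.
  by rewrite sl2_id group1.
exact: center_SL2N.
Qed.
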